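(* For all integers $n,d$ with $1\le d\le n-2$, $$A(n,d)\le \frac{n^{n-d}}{n-d+1}.$$ In particular, when $d=o(n)$, or when $d=\delta n$ for some constant $\delta\in(0,1)$, we have $A(n,d)=O(n^{n-d-1})$ (as $n\to\infty$).
   Context: $[n]=\{1,\dots,n\}$, and $\mathcal{T}(n)$ is the set of all spanning trees of the complete graph on vertex set $[n]$ (labelled trees on $[n]$). The tree-distance of $T_1=([n],E_1)$ and $T_2=([n],E_2)$ in $\mathcal{T}(n)$ is $d(T_1,T_2)=n-1-|E_1\cap E_2|$. $A(n,d)$ is the maximum size of a set $\mathcal{C}\subseteq\mathcal{T}(n)$ whose distinct elements have pairwise tree-distance at least $d$. In asymptotic statements $d=d(n)$ may depend on $n$ and $n\to\infty$. *)

(* Defs.v *)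
From mathcomp Require Import all_boot.
From mathcomp Require Import boolp.

Set Implicit Arguments.
Unset Strict Implicit.
Unset Printing Implicit Defensive.

(* The vertex set is 'I_n = {0, ..., n-1} in place of {1, ..., n}.  A graph on
   it is given by its edge set, a set of two-element subsets of 'I_n. *)

Definition adj (n : nat) (E : {set {set 'I_n}}) : rel 'I_n :=
  fun x y => (x != y) && ([set x; y] \in E).

Definition connected_graph (n : nat) (E : {set {set 'I_n}}) : Prop :=
  forall x y : 'I_n, connect (adj E) x y.

(* [ucycle] also accepts the empty sequence and the back-and-forth walk
   [:: x; y] along an edge; a cycle of a simple graph has at least three
   vertices. *)
Definition acyclic_graph (n : nat) (E : {set {set 'I_n}}) : Prop :=
  forall c : seq 'I_n, 2 < size c -> ~ ucycle (adj E) c.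

Definition is_spanning_tree (n : nat) (E : {set {set 'I_n}}) : Prop :=
  [/\ forall e : {set 'I_n}, e \in E -> #|e| = 2,
      connected_graph E
    & acyclic_graph E].

Definition spanning_trees (n : nat) : {set {set {set 'I_n}}} :=
  [set E : {set {set 'I_n}} | `[< is_spanning_tree E >]].

(* On spanning trees the subtractions do not truncate, as such a tree has
   n - 1 edges. *)
Definition tree_dist (n : nat) (E1 E2 : {set {set 'I_n}}) : nat :=
  n - 1 - #|E1 :&: E2|.

Definition is_tree_code (n d : nat) (C : {set {set {set 'I_n}}}) : bool :=
  (C \subset spanning_trees n) &&
  [forall E1 in C, forall E2 in C, (E1 != E2) ==> (d <= tree_dist E1 E2)].

Definition max_tree_code (n d : nat) : nat :=
  \max_(C : {set {set {set 'I_n}}} | is_tree_code d C) #|C|.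

(* Main.v *)
Require Import Defs.
From mathcomp Require Import all_boot.
From mathcomp Require Import boolp.

Set Implicit Arguments.
Unset Strict Implicit.
Unset Printing Implicit Defensive.

(** The bound is a double count of pairs (codeword E, rooted forest with d
    roots whose edges lie in E).

    A forest on n vertices with d components has n - d edges, while two distinct
    codewords share at most n - 1 - d edges, so a forest with d roots lies in at
    most one codeword.  The number of such pairs is therefore at most the number
    of all rooted forests with d roots, which is at most
    C(n-1, d-1) * n^(n-d) ([leq_card_forests]).  That estimate is Pitman's proof
    of Cayley's formula: deleting the edge from v to its parent u turns a forest
    with k roots into one with k+1 roots, and the old forest is recovered from
    the new one together with u and the root v, a root which is not that of u
    ([forests_recursion]).

    Conversely a codeword contains at least C(n-1, d-1) * (n-d+1) rooted forests
    with d roots ([card_subforests]).  Root a spanning tree of it at r and cut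
    off d - 1 vertices D other than r, then move a root to a vertex x outside D.
    The edge set of the result determines D and its set of roots determines x;
    there are C(n-1, d-1) choices of D and n - d + 1 choices of x.

    Dividing by the binomial coefficient gives |C| * (n-d+1) <= n^(n-d).  In
    both asymptotic regimes n - d + 1 is bounded below by a positive multiple of
    n, which turns this bound into O(n^(n-d-1)). *)

(** * Rooted forests as parent maps *)

Lemma card_dep_pairs (I J : finType) (A : {set I}) (B : I -> {set J}) :
  #|[set p : I * J | (p.1 \in A) && (p.2 \in B p.1)]| = \sum_(i in A) #|B i|.
Proof.
rewrite -sum1_card (eq_bigr (fun i => \sum_(j in B i) 1)); last first.
  by move=> i _; rewrite sum1_card.
by rewrite pair_big_dep /=; apply: eq_bigl => p; rewrite inE.
Qed.

(** A rooted forest on T is encoded by the map that sends each vertex to its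
    parent and each root to itself. *)
Section RootedForests.
Variable T : finType.
Implicit Types (f g : {ffun T -> T}) (x y z : T) (D : {set T}).

Definition roots f : {set T} := [set x | f x == x].

Definition forest f : bool := [forall x, exists z in roots f, fconnect f x z].

Definition edges f : {set {set T}} := [set [set x; f x] | x in ~: roots f].

Definition forests k : {set {ffun T -> T}} :=
  [set f | forest f & #|roots f| == k].

(** Each vertex of D loses its parent edge and becomes a root. *)
Definition cut f D : {ffun T -> T} := [ffun x => if x \in D then x else f x].

Lemma forestP f :
  reflect (forall x, exists k, iter k f x \in roots f) (forest f).
Proof.
apply: (iffP forallP) => fP x.
  have /exists_inP[z zr /iter_findex xz] := fP x.
  by exists (findex f x z); rewrite xz.
have [k kr] := fP x; apply/exists_inP.
by exists (iter k f x); last exact: fconnect_iter.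
Qed.

Lemma forest_rank f (h : T -> nat) :
  (forall x, x \notin roots f -> h (f x) < h x) -> forest f.
Proof.
move=> hf; apply/forestP => x.
have [m] := ubnP (h x); elim: m x => // m IHm x; rewrite ltnS => le_hm.
have [xr|xr] := boolP (x \in roots f); first by exists 0.
have [k kr] := IHm (f x) (leq_trans (hf x xr) le_hm).
by exists k.+1; rewrite iterSr.
Qed.

Lemma iter_root f x k : x \in roots f -> iter k f x = x.
Proof. by rewrite inE => /eqP fx; elim: k => //= k ->. Qed.

(** A cycle of the parent map repeats for ever, so the root that is reached from
    x lies on it; it is fixed, hence is x itself. *)
Lemma forest_cyclic_root f x k :
  forest f -> iter k.+1 f x = x -> x \in roots f.
Proof.
move=> /forestP/(_ x)[m mr] xk.
have loop j : iter (j * k.+1) f x = x.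
  by elim: j => // j IHj; rewrite mulSn iterD IHj.
suff mx : x = iter m f x by rewrite mx.
by rewrite -{1}(loop m) mulnC mulSn addnC iterD iter_root.
Qed.

(** Two vertices with the same parent edge would be parents of each other, a
    cycle of length two. *)
Lemma edge_inj f : forest f -> {in ~: roots f &, injective (fun x => [set x; f x])}.
Proof.
move=> ff x y; rewrite !inE => xr yr exy; apply/eqP/negPn/negP => nxy.
have: x \in [set y; f y] by rewrite -exy set21.
have: y \in [set x; f x] by rewrite exy set21.
rewrite !inE eq_sym (negbTE nxy) /= => /eqP yfx /eqP xfy.
have := @forest_cyclic_root f x 1 ff; rewrite /= -yfx -xfy inE.
by move=> /(_ erefl); rewrite (negbTE xr).
Qed.

Lemma card_edges f : forest f -> #|edges f| = #|T| - #|roots f|.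
Proof.
move=> ff; rewrite card_in_imset; last exact: edge_inj.
by rewrite cardsCs setCK.
Qed.

Lemma roots_cut f D : roots (cut f D) = D :|: roots f.
Proof. by apply/setP => x; rewrite !inE ffunE; case: ifP => //; rewrite eqxx. Qed.

Lemma forest_cut f D : forest f -> forest (cut f D).
Proof.
move=> /forestP ff; apply/forestP => x.
have [k] := ff x; elim: k x => [|k IHk] x kr.
  by exists 0; rewrite roots_cut inE kr orbT.
have [xD|xD] := boolP (x \in D); first by exists 0; rewrite roots_cut inE xD.
rewrite iterSr in kr; have [m mr] := IHk _ kr.
by exists m.+1; rewrite iterSr [cut f D x]ffunE (negbTE xD).
Qed.

(** Recovers D from the edges that remain, when D consists of non-roots. *)
Lemma mem_edges_cut f D x : forest f -> x \notin roots f ->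
  ([set x; f x] \in edges (cut f D)) = (x \notin D).
Proof.
move=> ff xr; apply/imsetP/idP => [[y]|xD]; last first.
  exists x; first by rewrite roots_cut in_setC in_setU negb_or xD.
  by rewrite ffunE (negbTE xD).
rewrite roots_cut !inE negb_or ffunE => /andP[yD yr].
rewrite (negbTE yD) => /(edge_inj ff) -> //; first by rewrite in_setC.
by rewrite !inE.
Qed.

Lemma edges_cut_sub f D : edges (cut f D) \subset edges f.
Proof.
apply/subsetP => _ /imsetP[x + ->]; rewrite roots_cut !inE negb_or ffunE.
move=> /andP[/negbTE-> xr]; apply/imsetP; exists x => //.
by rewrite !inE.
Qed.

(** Base case of the recursion on the number of roots: every vertex is a root. *)
Lemma forests_top : #|forests #|T| | <= 1.
Proof.
apply/card_le1_eqP => f g; rewrite !inE => /andP[_ fr] /andP[_ gr].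
have all_roots h : #|roots h| == #|T| -> h =1 id.
  move=> /eqP hr x; apply/eqP.
  by have := in_setT x; rewrite -(subset_cardP _ (subsetT (roots h))) ?cardsT // inE.
by apply/ffunP => x; rewrite !all_roots.
Qed.

(** * Upper bound on the number of rooted forests *)

Definition root f x : T := odflt x [pick z in roots f | fconnect f x z].

Lemma rootP f x : forest f -> root f x \in roots f.
Proof.
move=> /forallP/(_ x)/exists_inP[z zr xz]; rewrite /root.
by case: pickP => [y /andP[]//|/(_ z)]; rewrite zr xz.
Qed.

Lemma fconnect_root f x : forest f -> fconnect f x (root f x).
Proof.
move=> /forallP/(_ x)/exists_inP[z zr xz]; rewrite /root.
by case: pickP => [y /andP[]//|/(_ z)]; rewrite zr xz.
Qed.

(** If v were reached again from its former parent, then the same walk in f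
    would close a cycle through v. *)
Lemma root_cut1 f v : forest f -> v \notin roots f ->
  root (cut f [set v]) (f v) != v.
Proof.
move=> ff vr; apply: contra vr => /eqP rv.
have := fconnect_root (f v) (forest_cut [set v] ff); rewrite rv.
move=> /iter_findex; set k := findex _ _ _.
have reach : forall j y, iter j (cut f [set v]) y = v -> exists i, iter i f y = v.
  elim=> [|j IHj] y; first by exists 0.
  have [-> _|yv] := eqVneq y v; first by exists 0.
  rewrite iterSr [cut _ _ y]ffunE inE (negbTE yv) => /IHj[i yi].
  by exists i.+1; rewrite iterSr.
by move=> /reach[i]; rewrite -iterSr; exact: forest_cyclic_root.
Qed.

(** The left-hand side counts pairs (f, v) with v not a root, the right-hand
    side triples (g, u, v) with v a root of g other than the root of u.  Cutting f
    above v and recording u = f v is an injection from the former to the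
    latter. *)
Lemma forests_recursion k :
  #|forests k| * (#|T| - k) <= #|forests k.+1| * (#|T| * k).
Proof.
pose A := [set p : {ffun T -> T} * T |
             (p.1 \in forests k) && (p.2 \in ~: roots p.1)].
pose B := [set q : {ffun T -> T} * (T * T) | (q.1 \in forests k.+1) &&
   (q.2 \in [set w | (w.1 \in setT) && (w.2 \in roots q.1 :\ root q.1 w.1)])].
have <- : #|A| = #|forests k| * (#|T| - k).
  rewrite (card_dep_pairs _ (fun f => ~: roots f)) -sum_nat_const.
  by apply: eq_bigr => f; rewrite inE => /andP[_ /eqP<-]; rewrite cardsCs setCK.
have <- : #|B| = #|forests k.+1| * (#|T| * k).
  rewrite (card_dep_pairs _ (fun f => [set w : T * T |
    (w.1 \in setT) && (w.2 \in roots f :\ root f w.1)])) -sum_nat_const.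
  apply: eq_bigr => f; rewrite inE => /andP[ff /eqP fk].
  rewrite (card_dep_pairs _ (fun x => roots f :\ root f x)) -cardsT -sum_nat_const; apply: eq_bigr => x _.
  by move: fk; rewrite (cardsD1 (root f x)) rootP // add1n => -[].
pose phi (p : {ffun T -> T} * T) := (cut p.1 [set p.2], (p.1 p.2, p.2)).
have phi_inj : injective phi.
  move=> [f v] [g w] [] /ffunP fg fvw vw; rewrite -vw in fg fvw *.
  congr pair; apply/ffunP => x; have := fg x; rewrite !ffunE inE.
  by case: eqVneq => // ->.
rewrite -(card_imset _ phi_inj); apply/subset_leq_card/subsetP.
move=> _ /imsetP[[f v]] + ->; rewrite !inE /= => /andP[/andP[ff /eqP fk] vr].
have vr' : v \notin roots f by rewrite inE.
rewrite forest_cut // roots_cut -fk cardsU1 vr' add1n eqxx /=.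
by rewrite eq_sym root_cut1 //= ffunE set11 eqxx.
Qed.

(** Product of the recursive inequalities over the first j steps down from the
    edgeless forest; the binomial coefficient absorbs the factors
    (|T| - i) / i. *)
Lemma leq_card_forests j : j < #|T| ->
  #|forests (#|T| - j)| <= 'C(#|T|.-1, j) * #|T| ^ j.
Proof.
elim: j => [|j IHj] jT; first by rewrite subn0 bin0 forests_top.
have := forests_recursion (#|T| - j.+1).
rewrite subKn ?(ltnW jT) // subnSK ?(ltnW jT) // => rec.
rewrite -(leq_pmul2r (ltn0Sn j)); apply: leq_trans rec _.
apply: (leq_trans (leq_mul (IHj (ltnW jT)) (leqnn _))).
have -> : #|T| - j.+1 = #|T|.-1 - j by rewrite -subn1 -subnDA add1n.
rewrite expnSr; apply/eq_leq.
have := mul_bin_left #|T|.-1 j.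
move: (#|T|.-1 - j) 'C(_, j.+1) 'C(_, j) (#|T| ^ j) => a b c e Hab.
rewrite [RHS]mulnAC [b * _]mulnC Hab.
by rewrite -!mulnA [RHS]mulnCA; congr (_ * _); rewrite mulnA [RHS]mulnC.
Qed.

(** * Rooted forests inside a rooted tree *)

(** Reversing the path from x to its root makes x the root of its component
    without changing any edge.  The induction is on the length of this path: once
    the parent y of x has been made a root, only the edge from x to y has to be
    reversed.  If x is already a root then g = f. *)
Lemma reroot f x : forest f -> exists2 g, forest g &
  [/\ edges g = edges f, x \in roots g & roots g \subset x |: roots f].
Proof.
move=> ff; have /forestP/(_ x)[k] := ff.
elim: k x => [|k IHk] x kr; first by exists f; rewrite // subsetUr.
have [xr|xr] := boolP (x \in roots f); first by exists f; rewrite // subsetUr.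
rewrite iterSr in kr; have {IHk kr} [g gf [eg yg gr]] := IHk _ kr.
set y := f x in yg gr.
have xy : x != y by move: xr; rewrite inE eq_sym.
have gx : g x = y.
  (* The edge {x, y} is still present and its end y is now a root, so it can
     only be the parent edge of x. *)
  have: [set x; y] \in edges g by rewrite eg; apply: imset_f; rewrite inE.
  move=> /imsetP[w]; rewrite inE => wr xyw.
  have: w \in [set x; y] by rewrite xyw set21.
  rewrite !inE => /orP[] /eqP wE; last by rewrite wE yg in wr.
  have: y \in [set w; g w] by rewrite -xyw set22.
  by rewrite wE !inE eq_sym (negbTE xy) => /eqP.
pose h : {ffun T -> T} :=
  [ffun z => if (z == x) || (z == y) then x else g z].
have hx : h x = x by rewrite ffunE eqxx.
have hy : h y = x by rewrite ffunE eqxx orbT.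
have hg z : z != x -> z != y -> h z = g z.
  by move=> /negbTE zx /negbTE zy; rewrite ffunE zx zy.
have xh : x \in roots h by rewrite inE hx.
exists h.
  apply/forestP => z; have /forestP/(_ z)[m] := gf.
  elim: m z => [|m IHm] z.
    have [-> _|zx] := eqVneq z x; first by exists 0.
    have [-> _|zy zg] := eqVneq z y; first by exists 1; rewrite /= hy.
    by exists 0; rewrite inE /= hg //; move: zg; rewrite inE.
  have [-> _|zx] := eqVneq z x; first by exists 0.
  have [-> _|zy] := eqVneq z y; first by exists 1; rewrite /= hy.
  by rewrite iterSr -hg // => /IHm[i zi]; exists i.+1; rewrite iterSr.
split=> //; last first.
  apply/subsetP => z zh; rewrite inE in_set1.
  have [//|zx] := eqVneq z x.
  have [zy|zy] := eqVneq z y.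
    by move: zh; rewrite inE zy hy (negbTE xy).
  have: z \in roots g by move: zh; rewrite !inE hg.
  by move=> /(subsetP gr); rewrite !inE (negbTE zy).
rewrite -eg; apply/setP => e; apply/imsetP/imsetP => -[z]; rewrite !inE => zr ->.
  have zx : z != x by apply: contraNneq zr => ->; rewrite hx.
  have [->|zy] := eqVneq z y.
    exists x; first by rewrite !inE gx eq_sym.
    by rewrite hy gx setUC.
  by exists z; rewrite ?inE ?hg // -(hg z zx zy).
have zy : z != y by apply: contraNneq zr => ->; move: yg; rewrite inE.
have [->|zx] := eqVneq z x.
  by exists y; rewrite ?inE hy ?gx // setUC.
by exists z; rewrite ?inE hg.
Qed.

(** Breadth-first tree: the parent of x is the next vertex on a shortest walk
    from x to r, so that the distance to r decreases along the parent map. *)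
Lemma spanning_forest (e : rel T) r : (forall x, connect e x r) ->
  exists2 p : {ffun T -> T}, forest p &
    roots p = [set r] /\ forall x, x != r -> e x (p x).
Proof.
move=> conn.
pose walk x m := `[< exists s, [/\ path e x s, last x s = r & size s = m] >].
have walkE x : exists m, walk x m.
  by have /connectP[s sP sr] := conn x; exists (size s); apply/asboolP; exists s.
pose dist x := ex_minn (walkE x).
have step x : exists y, if x == r then y = r else e x y /\ dist y < dist x.
  case: eqVneq => [_|xr]; first by exists r.
  rewrite [dist x]/dist; case: ex_minnP => m /asboolP[[|y s] [/= sP sr sm]] _.
    by rewrite sr eqxx in xr.
  have /andP[exy ys] := sP; exists y; split=> //; rewrite /dist.
  case: ex_minnP => m' _ /(_ (size s)); rewrite -sm ltnS; apply.
  by apply/asboolP; exists s.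
have [q qP] := boolp.choice step; pose p := [ffun x => q x].
have pr : p r = r by have := qP r; rewrite ffunE eqxx.
have pP x : x != r -> e x (p x) /\ dist (p x) < dist x.
  by have := qP x; rewrite ffunE; case: eqVneq.
have roots_p : roots p = [set r].
  apply/setP => x; rewrite !inE; have [->|xr] := eqVneq x r; first by rewrite pr eqxx.
  by apply/eqP => px; have [_] := pP x xr; rewrite px ltnn.
exists p.
  by apply: (@forest_rank p dist) => x; rewrite roots_p inE => /pP[].
by split=> // x /pP[].
Qed.

(** The forests are obtained by cutting p above a k-subset D of the vertices
    other than r and then rerooting at a vertex x outside D, where x = r stands
    for leaving the roots of the cut forest as they are.  Rerooting preserves the
    edges, which determine D.  As x is the only root that can lie outside
    r |: D, another choice x' giving the same forest forces both to be r. *)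
Lemma card_subforests p r k : forest p -> roots p = [set r] -> k < #|T| ->
  'C(#|T|.-1, k) * (#|T| - k)
    <= #|[set f in forests k.+1 | edges f \subset edges p]|.
Proof.
move=> pf pr kT.
pose cuts := [set D : {set T} | D \subset [set~ r] & #|D| == k].
pose A := [set q : {set T} * T | (q.1 \in cuts) && (q.2 \in ~: q.1)].
have <- : #|A| = 'C(#|T|.-1, k) * (#|T| - k).
  rewrite (card_dep_pairs _ (fun D => ~: D)) -(cardsC1 r) -cards_draws -sum_nat_const.
  by apply: eq_bigr => D; rewrite inE => /andP[_ /eqP<-]; rewrite cardsCs setCK.
have cutP (q : {set T} * T) := reroot q.2 (forest_cut q.1 pf).
have {cutP} cutP q : exists g, forest g /\ [/\ edges g = edges (cut p q.1),
    q.2 \in roots g & roots g \subset q.2 |: roots (cut p q.1)].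
  by have [g] := cutP q; exists g.
have [phi phiP] := boolp.choice cutP.
have cutsr D : D \in cuts -> r \notin D.
  by rewrite inE subsetC sub1set inE => /andP[].
have phi_inj : {in A &, injective phi}.
  move=> [D x] [D' x']; rewrite !inE -!/(cuts) /= => /andP[Dc xD] /andP[Dc' xD'] eqphi.
  have [_ [ed xg sg]] := phiP (D, x); have [_ [ed' xg' sg']] := phiP (D', x').
  rewrite /= in ed xg sg ed' xg' sg'.
  have DD' : D = D'.
    apply/setP => y; have [->|yr] := eqVneq y r.
      by rewrite !(negbTE (cutsr _ _)) // inE.
    have yr' : y \notin roots p by rewrite pr inE.
    apply/negb_inj.
    by rewrite -(mem_edges_cut D pf yr') -(mem_edges_cut D' pf yr') -ed eqphi ed'.
  rewrite -{D' Dc' ed'}DD' in eqphi xD' xg' sg' *; congr pair.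
  move: xg xg'; rewrite eqphi => /(subsetP sg') xs; rewrite -eqphi => /(subsetP sg).
  move: xs; rewrite roots_cut pr !inE (negbTE xD) (negbTE xD') /=.
  by move=> /orP[/eqP//|/eqP->] /orP[/eqP//|/eqP->].
rewrite -(card_in_imset phi_inj); apply/subset_leq_card/subsetP.
move=> _ /imsetP[[D x] + ->]; rewrite inE /= => /andP[Dc xD].
have [gf [ge _ _]] := phiP (D, x); rewrite /= in ge.
rewrite !inE gf ge edges_cut_sub andbT /=.
have := card_edges gf; rewrite ge (card_edges (forest_cut D pf)).
have -> : #|roots (cut p D)| = k.+1.
  rewrite roots_cut pr setUC cardsU1 cutsr //; move: Dc; rewrite inE => /andP[_ /eqP->].
  by [].
move=> /(congr1 (fun m => #|T| - m)); rewrite !subKn ?max_card // => <-.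
by rewrite eqxx.
Qed.

End RootedForests.

(** * The bound for tree codes *)

(** Double count of the pairs (E, f) with E in C and f a forest with d roots and
    edges in E, divided by C(n-1, d-1). *)
Lemma tree_code_bound n d (C : {set {set {set 'I_n}}}) :
  0 < d <= n -> is_tree_code d C -> #|C| * (n - d + 1) <= n ^ (n - d).
Proof.
case: d => // k /= kn /andP[/subsetP Ctree /forall_inP Cdist].
have n_gt0 : 0 < n by apply: leq_ltn_trans kn.
pose inside (E : {set {set 'I_n}}) := [set f in forests 'I_n k.+1 | edges f \subset E].
have many E : E \in C -> 'C(n.-1, k) * (n - k) <= #|inside E|.
  move=> /Ctree; rewrite inE => /asboolP[_ conn _].
  have [p pf [pr pE]] := spanning_forest (fun x => conn x (Ordinal n_gt0)).
  have := card_subforests pf pr; rewrite card_ord => /(_ _ kn) /leq_trans; apply.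
  apply/subset_leq_card/subsetP => f; rewrite !inE => /andP[-> /subset_trans]; apply.
  apply/subsetP => _ /imsetP[x + ->]; rewrite pr !inE => /pE.
  by case/andP.
have unique E E' f : E \in C -> E' \in C -> f \in inside E -> f \in inside E' -> E = E'.
  move=> EC EC'; rewrite !inE => /andP[/andP[ff /eqP fk] fE] /andP[_ fE'].
  (* The n - d edges of f would all be common to E and E', which share at most
     n - 1 - d edges. *)
  apply/eqP; apply: contraT => EE'.
  have /forall_inP/(_ _ EC')/implyP/(_ EE') := Cdist _ EC.
  have : #|edges f| <= #|E :&: E'| by apply: subset_leq_card; rewrite subsetI fE.
  rewrite (card_edges ff) fk card_ord /tree_dist => le1 le2.
  have := leq_trans le2 (leq_sub2l _ le1).
  by rewrite -subnDA add1n subnSK // subKn ?ltnn // ltnW.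
have upper := @leq_card_forests 'I_n (n - k.+1).
rewrite card_ord in upper.
rewrite subKn // in upper.
have {upper} upper : #|forests 'I_n k.+1| <= 'C(n.-1, k) * n ^ (n - k.+1).
  rewrite -(@bin_sub n.-1 k); last by rewrite -ltnS prednK.
  have -> : n.-1 - k = n - k.+1 by rewrite -subn1 -subnDA add1n.
  by apply: upper; rewrite -subn_gt0 subKn.
have lower : #|C| * ('C(n.-1, k) * (n - k)) <= #|forests 'I_n k.+1|.
  rewrite -sum_nat_const; apply: (leq_trans (leq_sum _ many)).
  rewrite -(card_dep_pairs C inside).
  have snd_inj : {in [set q : _ * _ | (q.1 \in C) && (q.2 \in inside q.1)] &,
      injective (fun q => q.2)}.
    move=> [E f] [E' f'] /setIdP[/= EC fE] /setIdP[/= EC' fE'] ff'.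
    by rewrite -ff' in fE' *; rewrite (unique E E' f).
  rewrite -(card_in_imset snd_inj); apply/subset_leq_card/subsetP.
  by move=> _ /imsetP[[E f] + ->]; rewrite !inE /= => /andP[_ /andP[]].
have -> : n - k.+1 + 1 = n - k by rewrite addn1 subnSK.
have bin_gt : 0 < 'C(n.-1, k) by rewrite bin_gt0 -ltnS prednK.
rewrite -(leq_pmul2l bin_gt) mulnCA.
exact: leq_trans lower upper.
Qed.
Lemma max_tree_code_bound n d :
  0 < d <= n -> max_tree_code n d * (n - d + 1) <= n ^ (n - d).
Proof.
move=> dn; rewrite /max_tree_code; elim/big_ind: _ => [|a b Ha Hb|C].
- by [].
- by rewrite maxnMl geq_max Ha Hb.
- exact: tree_code_bound.
Qed.

From mathcomp Require Import all_order all_algebra.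
From mathcomp Require Import all_classical all_reals all_analysis.
From mathcomp Require Import lra.

Import Order.TTheory GRing.Theory Num.Theory.
Import numFieldNormedType.Exports.

Local Open Scope classical_set_scope.
Local Open Scope ring_scope.

Lemma max_tree_code_le (R : realType) n d : (1 <= d <= n - 2)%N ->
  (max_tree_code n d)%:R <= n%:R ^+ (n - d) / (n - d + 1)%:R :> R.
Proof.
move=> /andP[d_gt0 dn].
rewrite ler_pdivlMr ?ltr0n ?addn1 // -addn1 -natrX -natrM ler_nat.
by apply: max_tree_code_bound; rewrite d_gt0 (leq_trans dn) ?leq_subr.
Qed.

(** * Asymptotics *)

(** The bound is n^(n-d-1) * (n / (n-d+1)), and the second factor is at most
    1 / c. *)
Lemma max_tree_code_bigO (R : realType) (d : nat -> nat) (c : R) : 0 < c ->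
  (\forall n \near \oo, (1 <= d n <= n - 2)%N) ->
  (\forall n \near \oo, c * n%:R <= (n - d n + 1)%:R) ->
  (fun n : nat => (max_tree_code n (d n))%:R : R)
    =O_\oo (fun n : nat => n%:R ^+ (n - d n - 1) : R).
Proof.
move=> c_gt0 dP cP; apply/eqOP; near=> K.
near=> n.
have dn : (1 <= d n <= n - 2)%N by near: n.
have cn : c * n%:R <= (n - d n + 1)%:R by near: n.
have n_gt0 : (0 < n)%N.
  by case/andP: dn => d1 /(leq_trans d1); rewrite subn_gt0; exact: leq_trans.
rewrite !ger0_norm ?exprn_ge0 ?ler0n //.
apply: le_trans (max_tree_code_le R dn) _.
have denom_gt0 : 0 < (n - d n + 1)%:R :> R by rewrite ltr0n addn1.
rewrite ler_pdivrMr //.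
have {1}-> : (n - d n = (n - d n - 1).+1)%N.
  rewrite subn1 prednK // subn_gt0; case/andP: dn => _ /leq_ltn_trans; apply.
  by rewrite ltn_subrL.
rewrite exprSr [K * _]mulrC -mulrA ler_wpM2l ?exprn_ge0 ?ler0n //.
apply: le_trans (_ : c^-1 * (n - d n + 1)%:R <= _).
  by rewrite mulrC ler_pdivlMr // mulrC.
by apply: ler_wpM2r; rewrite ?ler0n.
Unshelve. all: by end_near.
Qed.

Theorem mainTheorem1 (R : realType) :
  (forall n d : nat, (1 <= d <= n - 2)%N ->
     (max_tree_code n d)%:R <= n%:R ^+ (n - d) / (n - d + 1)%:R :> R)
  /\
  (forall d : nat -> nat,
     (\forall n \near \oo, (1 <= d n <= n - 2)%N) ->
     ((fun n : nat => (d n)%:R : R) =o_\oo (fun n : nat => n%:R : R)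
      \/
      (exists delta : R, 0 < delta < 1 /\
         \forall n \near \oo, `|(d n)%:R - delta * n%:R| < 1)) ->
     (fun n : nat => (max_tree_code n (d n))%:R : R)
       =O_\oo (fun n : nat => n%:R ^+ (n - d n - 1) : R)).
Proof.
split; first exact: max_tree_code_le.
move=> d dP d_small.
suff [c c_gt0 cP] : exists2 c : R, 0 < c &
    \forall n \near \oo, c * n%:R <= (n%:R - (d n)%:R) + 1.
  apply: (max_tree_code_bigO c_gt0 dP); near=> n.
  have /andP[_ dn] : (1 <= d n <= n - 2)%N by near: n.
  rewrite natrD natrB ?(leq_trans dn) ?leq_subr //.
  by near: n.
case: d_small => [/eqoP dn|[delta [/andP[_ delta_lt1] dn]]].
  (* Eventually d <= n / 2. *)
  exists 2^-1; first by rewrite invr_gt0.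
  have half_gt0 : 0 < 2^-1 :> R by rewrite invr_gt0.
  near=> n.
  have : `|(d n)%:R : R| <= 2^-1 * `|n%:R : R| by near: n; exact: dn.
  by rewrite !ger0_norm ?ler0n //; lra.
(* From d < delta * n + 1 follows n - d + 1 > (1 - delta) * n. *)
exists (1 - delta); first by rewrite subr_gt0.
near=> n.
have : `|(d n)%:R - delta * n%:R| < 1 by near: n.
by rewrite ltr_norml => /andP[_]; lra.
Unshelve. all: by end_near.
Qed.
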